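(* Let $X$ be a compact and countably infinite metrizable space. Then every compact subset of $c_0(\omega_0)$ can be isometrically embedded into the space $(\mathrm{Met}(X),\mathcal{D}_X)$. Namely, the space $(\mathrm{Met}(X),\mathcal{D}_X)$ is universal for all compact subsets of $c_0(\omega_0)$.
   Context: For a metrizable space $X$, $\mathrm{Met}(X)$ is the set of all metrics on $X$ that generate the given topology of $X$, equipped with the sup-metric $\mathcal{D}_X(d,e)=\sup_{x,y\in X}|d(x,y)-e(x,y)|$. $\omega_0=\mathbb{Z}_{\ge 0}$ is the first infinite ordinal, and $c_0(\omega_0)$ is the set of all maps $f\colon\omega_0\to\mathbb{R}$ with $\lim_{n\to\infty}f(n)=0$, equipped with the supremum metric; subsets carry the restricted metric. A space $(M,\rho)$ is universal for a class of metric spaces if every member of the class admits an isometric (distance-preserving, not necessarily surjective) embedding into $(M,\rho)$. *)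

(* Defs.v *)
From HB Require Import structures.
From mathcomp Require Import all_boot all_order all_algebra.
From mathcomp Require Import all_classical all_reals all_analysis.

Set Implicit Arguments.
Unset Strict Implicit.
Unset Printing Implicit Defensive.

Import Order.TTheory GRing.Theory Num.Theory.
Import numFieldNormedType.Exports.

Local Open Scope classical_set_scope.
Local Open Scope ring_scope.

(* Nonnegativity of d follows from the other axioms. *)
Record is_metric (R : realType) (X : Type) (d : X -> X -> R) : Prop := IsMetric {
  is_metric_eq0 : forall x y, d x y = 0 <-> x = y ;
  is_metric_sym : forall x y, d x y = d y x ;
  is_metric_triangle : forall x y z, d x z <= d x y + d y z }.

Definition generates_topology (R : realType) (X : topologicalType)
    (d : X -> X -> R) : Prop :=
  forall U : set X, open U <->
    (forall x, U x -> exists2 e : R, 0 < e & [set y | d x y < e] `<=` U).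

Definition Met (R : realType) (X : topologicalType) : set (X -> X -> R) :=
  [set d | is_metric d /\ generates_topology d].
Arguments Met : clear implicits.

Definition metrizable (R : realType) (X : topologicalType) : Prop :=
  Met R X !=set0.

(* Extended-real valued, since the supremum is infinite for some pairs of
   metrics when X is not compact. *)
Definition metD (R : realType) (X : Type) (d e : X -> X -> R) : \bar R :=
  ereal_sup [set `|d p.1 p.2 - e p.1 p.2|%:E | p in [set: X * X]].
Arguments metD : clear implicits.

Record c0 (R : realType) := C0 {
  c0_val :> nat -> R ;
  c0_cvg : c0_val n @[n --> \oo] --> (0 : R) }.

Section c0_metric.
Context {R : realType}.
Implicit Types f g h : c0 R.

HB.instance Definition _ := gen_eqMixin (c0 R).
HB.instance Definition _ := gen_choiceMixin (c0 R).

Definition c0_dist f g : R := sup [set `|f n - g n| | n in [set: nat]].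

Lemma c0_has_sup f g : has_sup [set `|f n - g n| | n in [set: nat]].
Proof.
split; first by exists `|f 0%N - g 0%N|, 0%N.
have cfg : cvgn (fun n => f n - g n).
  by apply: (@is_cvgB _ _ _ _ _ (f : nat -> R) (g : nat -> R));
     apply/cvg_ex; exists 0; exact: c0_cvg.
have [M [_ HM]] := cvg_seq_bounded cfg.
exists (M + 1) => _ [n _ <-].
by apply: (HM (M + 1)) => //; rewrite ltrDl.
Qed.

Lemma c0_dist_ub f g n : `|f n - g n| <= c0_dist f g.
Proof. by apply: (ub_le_sup (proj2 (c0_has_sup f g))); exists n. Qed.

Lemma c0_dist_le f g (M : R) :
  (forall n, `|f n - g n| <= M) -> c0_dist f g <= M.
Proof.
move=> fgM; apply: ge_sup; first exact: (proj1 (c0_has_sup f g)).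
by move=> _ [n _ <-].
Qed.

Lemma c0_ext f g : (forall n, f n = g n) -> f = g.
Proof.
case: f g => [f cf] [g cg] /= fg.
have {}fg : f = g by apply/funext.
by subst g; congr C0; exact: Prop_irrelevance.
Qed.

Lemma c0_distxx f : c0_dist f f = 0.
Proof.
apply/eqP; rewrite eq_le; apply/andP; split.
  by apply: c0_dist_le => n; rewrite subrr normr0.
exact: le_trans (normr_ge0 _) (c0_dist_ub f f 0%N).
Qed.

Lemma c0_dist_positivity f g : c0_dist f g = 0 -> f = g.
Proof.
move=> fg0; apply: c0_ext => n.
by apply/eqP; rewrite -subr_eq0 -normr_le0 -fg0 c0_dist_ub.
Qed.

Lemma c0_dist_sym f g : c0_dist f g = c0_dist g f.
Proof.
by rewrite /c0_dist; congr sup; apply: eq_imagel => n _; rewrite distrC.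
Qed.

Lemma c0_dist_triangle g f h : c0_dist f h <= c0_dist f g + c0_dist g h.
Proof.
apply: c0_dist_le => n; apply: le_trans (ler_distD (g n) _ _) _.
by apply: lerD; exact: c0_dist_ub.
Qed.

HB.instance Definition _ := @isMetric.Build R (c0 R) c0_dist
  c0_distxx c0_dist_positivity c0_dist_sym c0_dist_triangle.

Lemma c0_mdistE f g : mdist f g = c0_dist f g.
Proof. by []. Qed.

End c0_metric.

Definition isometric_embedding (R : realType) (T : metricType R) (A : set T)
    (U : Type) (B : set U) (rho : U -> U -> \bar R) (phi : T -> U) : Prop :=
  (forall a, A a -> B (phi a)) /\
  (forall a b, A a -> A b -> rho (phi a) (phi b) = (mdist a b)%:E).

(* Universality of (B, rho) for a class C of subspaces of a metric space T. *)
Definition universal_for (R : realType) (T : metricType R) (C : set (set T))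
    (U : Type) (B : set U) (rho : U -> U -> \bar R) : Prop :=
  forall A : set T, C A ->
    exists phi : T -> U, isometric_embedding A B rho phi.

(* Main.v *)
(* By Baire, a countably infinite compact metrizable space has infinitely many
   isolated points b_0, b_1, ....  Let d be a compatible metric and let g be a
   null sequence dominating |f| for every f in K.  Define h_f to be g(n) + f(n)
   at b_(n+1) and 0 elsewhere.  Then d(x,y) + max(h_f(x), h_f(y)), for x <> y,
   is again a compatible metric, because h_f is a nonnegative function vanishing
   at infinity and supported on isolated points.  Since max is 1-Lipschitz for
   the sup norm, f |-> d_f does not increase distances, and evaluating at the
   pairs (b_(n+1), b_0) shows that it does not decrease them either. *)
Require Import Defs.
From mathcomp Require Import all_boot all_order all_algebra.
From mathcomp Require Import all_classical all_reals all_analysis.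

Set Implicit Arguments.
Unset Strict Implicit.
Unset Printing Implicit Defensive.

Local Open Scope classical_set_scope.
Local Open Scope ring_scope.

Import Order.TTheory GRing.Theory Num.Theory.
Import numFieldNormedType.Exports.

(** * Isolated points of countable compact spaces *)

Lemma infinite_set_injection (T : Type) (A : set T) :
  infinite_set A -> exists2 a : nat -> T, injective a & forall n, A (a n).
Proof.
elim/Ppointed: T => T in A *; first by rewrite emptyE => /infinite_setN0 [].
move=> /infiniteP/ppcard_leP[f]; exists f; last by move=> n; exact: funS.
by move=> m n; apply: inj; rewrite in_setT.
Qed.

(* Baire: were U free of open singletons, one could shrink it successively so
   as to avoid every point of the space. *)
Lemma countable_compact_open_singleton (X : topologicalType) (U : set X) :
  hausdorff_space X -> compact [set: X] -> countable [set: X] ->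
  open U -> U !=set0 -> exists2 x, U x & open [set x].
Proof.
move=> hX cX /countable_injP[e einj] oU U0; apply: contrapT => noiso.
pose good V := [/\ open V, V !=set0 & V `<=` U].
(* Goodness is assumed under the [exists] so that [choice] yields a total step function; [set0] is a
   dummy value for bad sets. *)
have shrink (p : nat * set X) : exists W, good p.2 ->
    [/\ good W, closure W `<=` p.2 & forall x, e x = p.1 -> ~ closure W x].
  case: p => n V /=; case: (pselect (good V)) => [[oV V0 VU]|nV]; last first.
    by exists set0.
  (* If every point of [V] had code [n], injectivity of [e] would make [V] an open singleton. *)
  have [y [Vy eyn]] : exists y, V y /\ e y <> n.
    apply: contrapT => Vn; case: V0 => x Vx; apply: noiso; exists x; first exact: VU.
    suff -> : [set x] = V by [].
    apply/seteqP; split => [_ -> //|z Vz] /=.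
    have en t : V t -> e t = n.
      by move=> Vt; apply: contrapT => et; apply: Vn; exists t.
    by apply: einj; rewrite ?in_setT// !en.
  have oV' : open (V `\` [set x | e x = n]).
    apply: openI => //; apply: closed_openC; have accX := hausdorff_accessible hX.
    apply: (accessible_finite_set_closed.1 accX).
    have [[x ex]|ne] := pselect (exists x, e x = n); last first.
      rewrite (_ : [set _ | _] = set0)//; apply/seteqP; split => // z ez.
      by apply: ne; exists z.
    apply: (sub_finite_set _ (finite_set1 x)) => z /= ez.
    by apply: einj; rewrite ?in_setT// ez ex.
  have nV'y : nbhs y (V `\` [set x | e x = n]).
    by apply: open_nbhs_nbhs; split.
  have [W nWy WV'] := compact_regular hX cX (@filterT _ _ (nbhs_filter y)) nV'y.
  exists W^° => _.
  have WW : closure W^° `<=` closure W by apply: closureS; exact: interior_subset.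
  split; first split.
  - exact: open_interior.
  - by exists y; exact: nWy.
  - by move=> z /interior_subset/subset_closure/WV'[/VU].
  - by move=> z /WW/WV'[].
  - by move=> z ezn /WW/WV'[].
have [step stepP] := choice shrink.
pose V := fix V n := if n is m.+1 then step (m, V m) else U.
have gV n : good (V n).
  by elim: n => [|n IHn]; [split|have [] := stepP (n, V n) IHn].
have VS n : closure (V n.+1) `<=` V n by have [] := stepP (n, V n) (gV n).
have Vmono m n : (m <= n)%N -> V n `<=` V m.
  move=> /subnK <-; elim: (n - m)%N => [//|k IHk].
  by apply: subset_trans IHk => z /subset_closure /VS.
have [y Vy] : {y : nat -> X & forall n, V n (y n)}.
  by apply: choice => n; have [] := gV n.
(* A cluster point [x] of the chosen points lies in every [closure (V n)], yet stage [e x] kept it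
   out of [closure (V (e x).+1)]. *)
have [x [_ clx]] := cX (y @ \oo) _ (filterT : (y @ \oo) setT).
have clV n : closure (V n) x.
  move: clx; rewrite clusterE; apply.
  by exists n => // m /= /Vmono; apply.
have [_ _ /(_ x erefl)] := stepP (e x, V (e x)) (gV (e x)).
by apply; exact: clV (e x).+1.
Qed.

(** Finitely many isolated points would form a closed set; its complement, open and nonempty as [X]
    is infinite, would again contain an isolated point. *)
Lemma infinite_open_singletons (X : topologicalType) :
  hausdorff_space X -> compact [set: X] -> countable [set: X] ->
  infinite_set [set: X] -> infinite_set [set x : X | open [set x]].
Proof.
move=> hX cX ctX iX fI.
have [x nIx] : ~` [set x : X | open [set x]] !=set0.
  apply/set0P/eqP => /(congr1 setC); rewrite setCK setC0 => IT.
  by apply: iX; rewrite -IT.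
have oI : open (~` [set x : X | open [set x]]).
  apply: closed_openC.
  exact: (accessible_finite_set_closed.1 (hausdorff_accessible hX)).
have [] := countable_compact_open_singleton hX cX ctX oI; first by exists x.
by move=> y.
Qed.

(** * Compatible metrics and weights added to them *)

Section metric_topology.
Context {R : realType} {X : topologicalType} {d : X -> X -> R}.
Hypothesis Md : Met R X d.

Lemma Met_self x : d x x = 0.
Proof. by have [[/(_ x x)[_ ->]]] := Md. Qed.

Lemma Met_ge0 x y : 0 <= d x y.
Proof.
have [[_ ds dt] _] := Md.
by have := dt x y x; rewrite Met_self (ds y x) -mulr2n pmulrn_lge0.
Qed.

Lemma Met_open_ball x (e : R) : open [set y | d x y < e].
Proof.
have [[_ ds dt] gd] := Md; apply/gd => y /= xy.
exists (e - d x y); first by rewrite subr_gt0.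
by move=> z /= yz; rewrite (le_lt_trans (dt x y z))// -ltrBrDl.
Qed.

Lemma Met_hausdorff : hausdorff_space X.
Proof.
have [[d0 ds dt] gd] := Md; move=> p q pq; apply/d0/eqP.
rewrite eq_le Met_ge0 andbT leNgt; apply/negP => dpq.
have d2 : 0 < d p q / 2 by rewrite divr_gt0.
have nb x : nbhs x [set y | d x y < d p q / 2].
  by apply: open_nbhs_nbhs; split; [exact: Met_open_ball|rewrite /= Met_self].
have [z /= [pz qz]] := pq _ _ (nb p) (nb q).
have := dt p z q; rewrite (ds z q) leNgt => /negP; apply.
by rewrite [ltRHS]splitr ltrD.
Qed.

End metric_topology.

(** The diagonal is set apart because [Num.max (h x) (h x)] is [h x], which need not vanish. *)
Definition add_weight {R : realType} {X : topologicalType} (d : X -> X -> R)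
    (h : X -> R) (x y : X) : R :=
  if x == y then 0 else d x y + Num.max (h x) (h y).

(** The triangle inequality holds because a maximum of nonnegative weights is at most the sum of the
    two maxima through [y]. For the topology, the new metric dominates [d]; conversely, a point with
    [h x != 0] is isolated, and near a point with [h x = 0] weights are small, as the finitely many
    points of large weight form a closed set. *)
Lemma add_weight_Met (R : realType) (X : topologicalType) (d : X -> X -> R)
    (h : X -> R) :
  Met R X d -> (forall x, 0 <= h x) ->
  (forall e : R, 0 < e -> finite_set [set x | e <= h x]) ->
  (forall x, h x != 0 -> open [set x]) ->
  Met R X (add_weight d h).
Proof.
move=> Md h0 hfin hiso; have [[d0 ds dt] gd] := Md.
have m0 x y : 0 <= Num.max (h x) (h y) by rewrite le_max h0.
have dge0 := Met_ge0 Md.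
have dle x y : d x y <= add_weight d h x y.
  rewrite /add_weight; case: eqP => [->|_]; first by rewrite (Met_self Md).
  by rewrite lerDl.
split; first split.
- move=> x y; split => [xy|->]; last by rewrite /add_weight eqxx.
  by apply/d0/eqP; rewrite eq_le dge0 andbT -xy.
- by move=> x y; rewrite /add_weight eq_sym ds maxC.
- move=> x y z; rewrite /add_weight.
  case: (eqVneq x y) => [->|xy]; first by rewrite add0r.
  case: (eqVneq y z) => [<-|yz]; first by rewrite (negbTE xy) addr0.
  case: eqP => [_|_]; first by rewrite !addr_ge0.
  rewrite addrACA; apply: lerD => //.
  rewrite ge_max; apply/andP; split.
    by rewrite -[leLHS]addr0 lerD// le_max lexx.
  by rewrite -[leLHS]add0r lerD// le_max lexx orbT.
- move=> U; split => [/gd oU x /oU[e e0 xU]|oU].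
    by exists e => // y /= xy; apply: xU; exact: le_lt_trans xy.
  apply/gd => x Ux; have [hx0|/hiso/gd/(_ x erefl)[e e0 xe]] := eqVneq (h x) 0; last first.
    by exists e => // y /xe ->.
  have [e e0 xU] := oU x Ux.
  have e2 : 0 < e / 2 by rewrite divr_gt0.
  have /gd/(_ x)[] : open (~` [set y | e / 2 <= h y]).
    apply: closed_openC; apply: (accessible_finite_set_closed.1 _ _ (hfin _ e2)).
    exact/hausdorff_accessible/(Met_hausdorff Md).
  - by rewrite /= hx0; apply/negP; rewrite -ltNge.
  (* Radius [r] keeps the weight of [y] below [e / 2]; the other bound does the same for [d x y]. *)
  move=> r r0 xr; exists (Num.min r (e / 2)); first by rewrite lt_min r0.
  move=> y /=; rewrite lt_min => /andP[/xr/= /negP + xy].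
  rewrite -ltNge => hy; apply: xU => /=; rewrite /add_weight; case: eqP => // _.
  by rewrite [ltRHS]splitr hx0 max_r// ltrD.
Qed.

Lemma dist_max_le (R : realDomainType) (a b a' b' M : R) :
  `|a - a'| <= M -> `|b - b'| <= M -> `|Num.max a b - Num.max a' b'| <= M.
Proof.
rewrite !ler_distl => /andP[a1 a2] /andP[b1 b2]; apply/andP; split.
  rewrite lerBlDr ge_max; move: a1 b1; rewrite !lerBlDr => a1 b1.
  by rewrite (le_trans a1) ?lerD2r ?le_max ?lexx// (le_trans b1)// lerD2r le_max lexx orbT.
rewrite ge_max; apply/andP; split.
  by rewrite (le_trans a2)// lerD2r le_max lexx.
by rewrite (le_trans b2)// lerD2r le_max lexx orbT.
Qed.

(** * Compact subsets of $c_0$ and weights carried by a sequence *)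

(** A tail index that suits [f] at tolerance [e / 2] suits its whole [e / 2]-ball at tolerance [e];
    the near-covering form of compactness makes the index uniform on [K]. *)
Lemma compact_c0_unif_cvg0 (R : realType) (K : set (c0 R)) (e : R) :
  compact K -> 0 < e -> \forall n \near \oo, forall f, K f -> `|f n| <= e.
Proof.
move=> /compact_near_coveringP cK e0.
apply: (cK nat \oo (fun n f => `|f n| <= e)) => f Kf.
have e2 : 0 < e / 2 by rewrite divr_gt0.
have /cvgr0Pnorm_lt/(_ _ e2) fn := @c0_cvg R f.
exists (ball f (e / 2), [set n | `|f n| < e / 2]).
  by split => //; exact: nbhsx_ballx.
move=> [g n] /= [+ fne]; rewrite ballEmdist /= c0_mdistE => fg.
rewrite -(subrK (f n) (g n)) (le_trans (ler_normD _ _))// [leRHS]splitr.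
apply: lerD; last exact: ltW.
by rewrite distrC (le_trans (c0_dist_ub _ _ _))// ltW.
Qed.

Lemma compact_c0_bounded (R : realType) (K : set (c0 R)) n :
  compact K -> has_ubound [set `|f n| | f in K].
Proof.
move=> /compact_near_coveringP cK.
have [M [_ KM]] : \forall M \near +oo, K `<=` (fun f : c0 R => `|f n| <= M).
  apply: cK => f Kf.
  exists (ball f 1, [set M | `|f n| + 1 <= M]).
    split; first exact: nbhsx_ballx.
    exact: nbhs_pinfty_ge.
  move=> [g M] /= [+ fM]; rewrite ballEmdist /= c0_mdistE => fg.
  rewrite (le_trans _ fM)// -(subrK (f n) (g n)) (le_trans (ler_normD _ _))//.
  by rewrite addrC lerD2l distrC (le_trans (c0_dist_ub _ _ _))// ltW.
exists (M + 1) => _ [f Kf <-]; apply: (KM (M + 1)) => //.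
by rewrite ltrDl.
Qed.

(** The pointwise supremum of [|f n|] over [K] works: it is finite by boundedness and tends to 0 by
    uniform decay. *)
Lemma compact_c0_dominated (R : realType) (K : set (c0 R)) : compact K ->
  exists2 g : nat -> R, g n @[n --> \oo] --> 0 &
    forall f n, K f -> `|f n| <= g n.
Proof.
move=> cK; exists (fun n => sup [set `|f n| | f in K]); last first.
  move=> f n Kf; apply: ub_le_sup; first exact: compact_c0_bounded.
  by exists f.
apply/cvgr0Pnorm_le => e e0; near=> n.
have Ke : forall f, K f -> `|f n| <= e.
  by near: n; exact: compact_c0_unif_cvg0.
have [K0|/set0P[f Kf]] := eqVneq K set0.
  by rewrite K0 image_set0 sup0 normr0 ltW.
rewrite ger0_norm.
  by apply: ge_sup => [|_ [h Kh <-]]; [exists `|f n|, f|exact: Ke].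
apply: le_trans (normr_ge0 (f n)) _; apply: ub_le_sup.
  exact: compact_c0_bounded.
by exists f.
Unshelve. all: by end_near. Qed.

(* The weight w n placed at a n, for injective a; off the range of a the value
   is sup set0 = 0. *)
Definition seq_weight {R : realType} {X : Type} (a : nat -> X)
    (w : nat -> R) (x : X) : R := sup [set w n | n in a @^-1` [set x]].


Section seq_weight.
Context {R : realType} {X : Type} {a : nat -> X} {w : nat -> R}.

Lemma seq_weight_in n : injective a -> seq_weight a w (a n) = w n.
Proof.
move=> ainj; rewrite /seq_weight (_ : _ @^-1` _ = [set n]).
  by rewrite image_set1 sup1.
by apply/seteqP; split=> [m /ainj|m ->].
Qed.

Lemma seq_weight_out x : (forall n, a n <> x) -> seq_weight a w x = 0.
Proof.
move=> ax; rewrite /seq_weight (_ : _ @^-1` _ = set0) ?image_set0 ?sup0//.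
by apply/seteqP; split=> // n /ax.
Qed.

End seq_weight.

(** The position of [x] is decided before [w] is chosen, so that two weights can be compared at the
    same point. *)
Lemma seq_weight_cases (R : realType) {X : Type} {a : nat -> X} (x : X) :
  injective a ->
  (exists2 n, x = a n & forall w : nat -> R, seq_weight a w x = w n) \/
  (forall w : nat -> R, seq_weight a w x = 0).
Proof.
move=> ainj; have [[n <-]|ax] := pselect (exists n, a n = x).
  by left; exists n => // w; exact: seq_weight_in.
by right=> w; apply: seq_weight_out => n anx; apply: ax; exists n.
Qed.

Lemma seq_weight_finite {R : realType} {X : Type} (a : nat -> X)
    (w : nat -> R) (e : R) : injective a -> w n @[n --> \oo] --> 0 -> 0 < e ->
  finite_set [set x | e <= seq_weight a w x].
Proof.
move=> ainj /cvgr0Pnorm_lt w0 e0; have [N _ wN] := w0 e e0.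
apply: (@sub_finite_set _ _ (a @` `I_N)); last exact: finite_image.
move=> x /=; have [[n -> ->]|->] := seq_weight_cases R x ainj; last by rewrite leNgt e0.
move=> ewn; exists n => //=; rewrite ltnNge; apply/negP => /wN /=.
by rewrite ltNge (le_trans ewn)// ler_norm.
Qed.

(** * The isometric embedding *)

Theorem theorem1p9 (R : realType) (X : topologicalType)
    (X_metrizable : metrizable R X)
    (X_compact : compact [set: X])
    (X_countable : countable [set: X])
    (X_infinite : infinite_set [set: X]) :
  universal_for [set K : set (c0 R) | compact K] (Met R X) (metD R X).
Proof.
move=> K /= cK; have [d Md] := X_metrizable.
have [b binj bopen] := infinite_set_injection (infinite_open_singletons
  (Met_hausdorff Md) X_compact X_countable X_infinite).
(* The shift leaves [b 0] outside the range of [a], so every weight vanishes there. *)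
pose a n := b n.+1.
have ainj : injective a by move=> m n /binj[].
have [g g0 Kg] := compact_c0_dominated cK.
(* Adding [g] makes the weights nonnegative for [f] in [K] and cancels in differences. *)
pose w (f : c0 R) n := g n + f n.
have w_ge0 f n : K f -> 0 <= w f n.
  by move=> Kf; rewrite -lerBlDl sub0r lerNl (le_trans _ (Kg f n Kf))// -normrN ler_norm.
have w0 f : w f n @[n --> \oo] --> 0.
  by rewrite -(addr0 (0 : R)); apply: cvgD => //; exact: c0_cvg.
exists (fun f => add_weight d (seq_weight a (w f))); split.
  move=> f Kf; apply: add_weight_Met => //.
  - by move=> x; have [[n _ ->]|->] := seq_weight_cases R x ainj; [exact: w_ge0|].
  - by move=> e e0; exact: seq_weight_finite.
  - move=> x; have [[n -> _]|->] := seq_weight_cases R x ainj; last by rewrite eqxx.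
    by move=> _; exact: bopen.
move=> f f' Kf Kf'; rewrite c0_mdistE.
have c0_ge0 : 0 <= c0_dist f f'.
  exact: le_trans (normr_ge0 _) (c0_dist_ub f f' 0%N).
have le_c0 x : `|seq_weight a (w f) x - seq_weight a (w f') x| <= c0_dist f f'.
  have [[n _ wn]|w0x] := seq_weight_cases R x ainj; last by rewrite !w0x subrr normr0.
  by rewrite !wn /w opprD addrACA subrr add0r c0_dist_ub.
have metD_le : (metD R X (add_weight d (seq_weight a (w f)))
    (add_weight d (seq_weight a (w f'))) <= (c0_dist f f')%:E)%E.
  apply: ge_ereal_sup => _ [[x y] _ <-]; rewrite lee_fin /= /add_weight.
  case: eqP => _; first by rewrite subrr normr0.
  by rewrite opprD addrACA subrr add0r; exact: dist_max_le.
have metD_ge n : (`|f n - f' n|%:E <= metD R X (add_weight d (seq_weight a (w f)))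
    (add_weight d (seq_weight a (w f'))))%E.
  apply: ereal_sup_ubound; exists (a n, b 0%N) => //=; congr EFin.
  have b0 m : a m <> b 0%N by move=> /binj.
  rewrite /add_weight; case: eqP => [/b0//|_].
  rewrite !seq_weight_in// !(seq_weight_out b0) !max_l ?w_ge0//.
  by rewrite opprD addrACA subrr add0r /w opprD addrACA subrr add0r.
(* The upper bound excludes [+oo], and the lower bound at index 0 excludes [-oo]. *)
move: metD_le metD_ge; case: (metD _ _ _ _) => [r| |] //=.
- move=> rle rge; congr EFin; apply/eqP; rewrite eq_le -lee_fin rle /=.
  by apply: c0_dist_le => n; rewrite -lee_fin.
- by move=> _ /(_ 0%N).
Qed.
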